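(* Let $\mathcal{B}$ be a unital C$^*$-algebra. For $i=1,2$ let $\mathfrak{T}^i$ be a spatial CPD-semigroup on a set $S^i$ with values in $\mathcal{B}(\mathcal{B})$, with unit $\mathfrak{S}^i$ given by $(\mathfrak{S}^i_t)^{s,s'}(b)=(c^{i,s}_t)^*b\,c^{i,s'}_t$ for a family $(c^{i,s})_{s\in S^i}$ of continuous semigroups in $\mathcal{B}$. On the disjoint union $S=S^1\uplus S^2$ define $\mathfrak{T}=\mathfrak{T}^1\boxplus\mathfrak{T}^2$ by $\mathfrak{T}^{s,s'}_t:=(\mathfrak{T}^i_t)^{s,s'}$ for $s,s'\in S^i$ ($i=1,2$), and $\mathfrak{T}^{s_i,s_j}_t(b):=(c^{i,s_i}_t)^*b\,c^{j,s_j}_t$ for $i\neq j$, $s_i\in S^i$, $s_j\in S^j$; define $\mathfrak{S}=\mathfrak{S}^1\boxplus\mathfrak{S}^2$ by the same formulas with $\mathfrak{S}^i$ in place of $\mathfrak{T}^i$. Then $\mathfrak{T}$ is a spatial CPD-semigroup with unit $\mathfrak{S}$. Moreover, $\mathfrak{T}$ is (strongly) continuous if and only if each $\mathfrak{T}^i$ is (strongly) continuous.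
   Context: A kernel $\mathfrak{K}:S\times S\to\mathcal{B}(\mathcal{B})$ is completely positive definite (CPD) if $\sum_{i,j}b_i^*\mathfrak{K}^{s_i,s_j}(a_i^*a_j)b_j\ge0$ for all finite choices $s_i\in S$, $a_i,b_i\in\mathcal{B}$. A CPD-semigroup on $S$ is a family $(\mathfrak{T}_t)_{t\ge0}$ of $\mathcal{B}(\mathcal{B})$-valued CPD-kernels on $S$ such that each $(\mathfrak{T}^{s,s'}_t)_{t\ge0}$ is a semigroup of maps on $\mathcal{B}$; strongly continuous means $t\mapsto\mathfrak{T}^{s,s'}_t(b)$ is norm continuous for all $s,s',b$. $\mathfrak{T}$ dominates $\mathfrak{S}$ if $\mathfrak{T}_t-\mathfrak{S}_t$ is CPD for all $t$. $\mathfrak{S}$ is elementary if $\mathfrak{S}^{s,s'}_t(b)=c^{s*}_tbc^{s'}_t$ for a family of continuous semigroups $(c^s_t)_{t\ge0}$ in $\mathcal{B}$. A unit for $\mathfrak{T}$ is an elementary CPD-semigroup dominated by $\mathfrak{T}$; $\mathfrak{T}$ is spatial if it has a unit. *)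

(* Defs.v *)
From HB Require Import structures.
From mathcomp Require Import all_boot all_order all_algebra.
From mathcomp Require Import reals.
From mathcomp Require Import complex.
Set Implicit Arguments. Unset Strict Implicit. Unset Printing Implicit Defensive.
Import Order.TTheory GRing.Theory Num.Theory.
Local Open Scope ring_scope.

Section Defs.
Variable R : realType.

Definition cabs (z : R[i]) : R := ComplexField.Normc.normc z.

Record cstar_algebra (B : algType R[i]) (star : B -> B) (nrm : B -> R) : Prop :=
  CStarAlgebra {
    star_add : forall x y, star (x + y) = star x + star y;
    star_scale : forall (a : R[i]) x, star (a *: x) = conjc a *: star x;
    star_mul : forall x y, star (x * y) = star y * star x;
    star_invol : forall x, star (star x) = x;
    nrm_eq0 : forall x, nrm x = 0 -> x = 0;
    nrm_add : forall x y, nrm (x + y) <= nrm x + nrm y;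
    nrm_scale : forall (a : R[i]) x, nrm (a *: x) = cabs a * nrm x;
    nrm_mul : forall x y, nrm (x * y) <= nrm x * nrm y;
    nrm_cstar : forall x, nrm (star x * x) = nrm x ^+ 2;
    nrm_complete : forall u : nat -> B,
      (forall e : R, 0 < e -> exists N, forall m n, (N <= m)%N -> (N <= n)%N ->
          nrm (u m - u n) < e) ->
      exists l : B, forall e : R, 0 < e -> exists N, forall n, (N <= n)%N ->
          nrm (u n - l) < e
  }.

Variables (B : algType R[i]) (star : B -> B) (nrm : B -> R).

Definition invertible (x : B) : Prop := exists y : B, y * x = 1 /\ x * y = 1.

Definition positive (b : B) : Prop :=
  star b = b /\
  forall l : R[i], ~ invertible (l%:A - b) -> 0 <= l.

Definition bounded_linear (f : B -> B) : Prop :=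
  (forall x y, f (x + y) = f x + f y) /\
  (forall (a : R[i]) x, f (a *: x) = a *: f x) /\
  exists M : R, forall x, nrm (f x) <= M * nrm x.

Definition CPD {S : Type} (K : S -> S -> B -> B) : Prop :=
  (forall s s', bounded_linear (K s s')) /\
  forall (n : nat) (s : 'I_n -> S) (a b : 'I_n -> B),
    positive (\sum_(i < n) \sum_(j < n) star (b i) * K (s i) (s j) (star (a i) * a j) * b j).

Definition CPD_semigroup {S : Type} (T : R -> S -> S -> B -> B) : Prop :=
  (forall t, 0 <= t -> CPD (T t)) /\
  (forall s s' b, T 0 s s' b = b) /\
  (forall t u s s' b, 0 <= t -> 0 <= u -> T (t + u) s s' b = T t s s' (T u s s' b)).

Definition norm_continuous (c : R -> B) : Prop :=
  forall t0, 0 <= t0 -> forall e : R, 0 < e -> exists d : R, 0 < d /\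
    forall t, 0 <= t -> `|t - t0| < d -> nrm (c t - c t0) < e.

Definition cont_semigroup (c : R -> B) : Prop :=
  c 0 = 1 /\ (forall t u, 0 <= t -> 0 <= u -> c (t + u) = c t * c u) /\
  norm_continuous c.

Definition strongly_continuous {S : Type} (T : R -> S -> S -> B -> B) : Prop :=
  forall s s' b, norm_continuous (fun t => T t s s' b).

(* (uniformly) continuous: t |-> T_t^{s,s'} continuous in the operator norm of B(B),
   i.e. ||T_t - T_t0|| <= e written out *)
Definition uniformly_continuous {S : Type} (T : R -> S -> S -> B -> B) : Prop :=
  forall s s' t0, 0 <= t0 -> forall e : R, 0 < e -> exists d : R, 0 < d /\
    forall t, 0 <= t -> `|t - t0| < d ->
      forall x, nrm (T t s s' x - T t0 s s' x) <= e * nrm x.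

Definition elementary_of {S : Type} (c : S -> R -> B) : R -> S -> S -> B -> B :=
  fun t s s' b => star (c s t) * b * c s' t.

Definition elementary {S : Type} (Sg : R -> S -> S -> B -> B) : Prop :=
  CPD_semigroup Sg /\
  exists c : S -> R -> B, (forall s, cont_semigroup (c s)) /\
    forall t s s' b, 0 <= t -> Sg t s s' b = elementary_of c t s s' b.

Definition dominates {S : Type} (T Sg : R -> S -> S -> B -> B) : Prop :=
  forall t, 0 <= t -> CPD (fun s s' b => T t s s' b - Sg t s s' b).

Definition is_unit {S : Type} (T Sg : R -> S -> S -> B -> B) : Prop :=
  elementary Sg /\ dominates T Sg.

Definition spatial {S : Type} (T : R -> S -> S -> B -> B) : Prop :=
  CPD_semigroup T /\ exists Sg, is_unit T Sg.

Definition boxplus {S1 S2 : Type} (T1 : R -> S1 -> S1 -> B -> B)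
  (T2 : R -> S2 -> S2 -> B -> B) (c1 : S1 -> R -> B) (c2 : S2 -> R -> B) :
  R -> (S1 + S2)%type -> (S1 + S2)%type -> B -> B :=
  fun t s s' b =>
    match s, s' with
    | inl x, inl y => T1 t x y b
    | inr x, inr y => T2 t x y b
    | inl x, inr y => star (c1 x t) * b * c2 y t
    | inr x, inl y => star (c2 x t) * b * c1 y t
    end.

End Defs.

(* Main.v *)
Require Import Defs.
From HB Require Import structures.
From mathcomp Require Import all_boot all_order all_algebra.
From mathcomp Require Import reals complex boolp ring lra.
Import Order.TTheory GRing.Theory Num.Theory.
Local Open Scope ring_scope.

(* The kernel T_t splits as the zero extensions of T1_t - S1_t and T2_t - S2_t to
   the disjoint union plus the elementary kernel of (c^s)_s, so T_t and T_t - S_t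
   are CPD as soon as squares x^* x and sums of positive elements are positive.
   Squares are positive because T_0 is the identity kernel and is CPD. For sums,
   a self-adjoint a is positive iff |r - a| <= r for some r, and this condition is
   additive. The equivalence rests on |h| being attained, up to sign, in the spectrum
   of a self-adjoint h, which is derived from square roots of 1 - l, |l| < 1,
   without holomorphic functional calculus. *)

(** * Decay of geometric sequences *)

Lemma expr_small (R : realType) (q e : R) : 0 <= q -> q < 1 -> 0 < e ->
  exists N, forall n, (N <= n)%N -> q ^+ n < e.
Proof.
move=> q0 q1 e0.
(* A form of Bernoulli's inequality: [q ^+ n] decays at least like [1/n], and the archimedean
   property then provides [N]. *)
have bern n : q ^+ n * (1 + n%:R * (1 - q)) <= 1.
  elim: n => [|n IHn]; first by rewrite expr0 mul0r addr0 mulr1.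
  apply: le_trans IHn; rewrite exprSr -mulrA ler_wpM2l ?exprn_ge0 //.
  rewrite -natr1; have n0 : 0 <= n%:R :> R by [].
  have : 0 <= (n%:R + 1) * (1 - q) ^+ 2 by rewrite mulr_ge0 ?sqr_ge0 ?addr_ge0.
  lra.
exists (Num.bound (e * (1 - q))^-1) => n Nn.
have d0 : 0 < 1 - q by rewrite subr_gt0.
have hn : (e * (1 - q))^-1 < n%:R.
  apply: lt_le_trans (_ : (Num.bound (e * (1 - q))^-1)%:R <= _); last by rewrite ler_nat.
  by apply: archi_boundP; rewrite invr_ge0 mulr_ge0 // ltW.
have {}hn : 1 < n%:R * (e * (1 - q)) by rewrite -ltr_pdivrMr ?mulr_gt0 // mul1r.
rewrite ltNge; apply/negP => he.
have := bern n; rewrite leNgt => /negP; apply.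
have n0 : 0 <= n%:R :> R by [].
have : e * (1 + n%:R * (1 - q)) <= q ^+ n * (1 + n%:R * (1 - q)).
  by rewrite ler_wpM2r // addr_ge0 // mulr_ge0 // ltW.
by nra.
Qed.

(** * Elementary rules for norm and involution *)

Section CStar.
Context {R : realType} {B : algType R[i]} {star : B -> B} {nrm : B -> R}.
Hypothesis HB : cstar_algebra star nrm.
Local Open Scope complex_scope.

Lemma cabs_real (r : R) : cabs r%:C = `|r|.
Proof. by rewrite /cabs /= expr0n addr0 sqrtr_sqr. Qed.

Lemma nrm_rscale (r : R) x : nrm (r%:C *: x) = `|r| * nrm x.
Proof. by rewrite (nrm_scale HB) cabs_real. Qed.

Lemma nrm_pscale (r : R) x : 0 <= r -> nrm (r%:C *: x) = r * nrm x.
Proof. by move=> r0; rewrite nrm_rscale ger0_norm. Qed.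

Lemma nrm0 : nrm 0 = 0.
Proof. by rewrite -(scale0r 0) (nrm_rscale 0) normr0 mul0r. Qed.

Lemma nrmN x : nrm (- x) = nrm x.
Proof.
have := nrm_rscale (-1) x; rewrite rmorphN1 scaleN1r => ->.
by rewrite normrN1 mul1r.
Qed.

Lemma nrmB x y : nrm (x - y) <= nrm x + nrm y.
Proof. by rewrite -(nrmN y) (nrm_add HB). Qed.

Lemma nrm_distC x y : nrm (x - y) = nrm (y - x).
Proof. by rewrite -nrmN opprB. Qed.

Lemma nrm_dist_triangle y x z : nrm (x - z) <= nrm (x - y) + nrm (y - z).
Proof. by rewrite -[x - z](subrKA y) (nrm_add HB). Qed.

Lemma nrm_ge0 x : 0 <= nrm x.
Proof. by have := nrmB x x; rewrite subrr nrm0; lra. Qed.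

Lemma star1 : star 1 = 1.
Proof.
by rewrite -[LHS]mulr1 -{2}(star_invol HB 1) -(star_mul HB) mulr1 (star_invol HB).
Qed.

Lemma star0 : star 0 = 0.
Proof. by apply: (addrI (star 0)); rewrite -(star_add HB) !addr0. Qed.

Lemma starN x : star (- x) = - star x.
Proof. by apply/eqP; rewrite -addr_eq0 -(star_add HB) addNr star0. Qed.

Lemma starB x y : star (x - y) = star x - star y.
Proof. by rewrite (star_add HB) starN. Qed.

Lemma star_rscale (r : R) x : star (r%:C *: x) = r%:C *: star x.
Proof. by rewrite (star_scale HB) conjc_real. Qed.

Lemma star_sum (I : Type) (r : seq I) (P : pred I) (F : I -> B) :
  star (\sum_(i <- r | P i) F i) = \sum_(i <- r | P i) star (F i).
Proof. exact: (big_morph star (star_add HB) star0). Qed.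

(** The C*-identity and submultiplicativity give |y|^2 <= |y^*| |y|, hence |y| <= |y^*|; this is
    applied to [x] and to [star x]. *)
Lemma nrm_star x : nrm (star x) = nrm x.
Proof.
have h y : nrm y <= nrm (star y).
  have [->|y0] := eqVneq (nrm y) 0; first exact: nrm_ge0.
  have yp : 0 < nrm y by rewrite lt0r y0 nrm_ge0.
  by rewrite -(ler_pM2r yp) -expr2 -(nrm_cstar HB) (nrm_mul HB).
by apply/le_anti; rewrite h -{2}(star_invol HB x) h.
Qed.

Lemma nrm_sqr_sa x : star x = x -> nrm (x * x) = nrm x ^+ 2.
Proof. by move=> sx; rewrite -{1}sx (nrm_cstar HB). Qed.

Lemma nrm1_le1 : nrm 1 <= 1.
Proof.
have := nrm_sqr_sa 1 star1; rewrite mulr1 => h.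
have := nrm_ge0 1; nra.
Qed.

Lemma nrm_alg_le (r : R) : nrm (r%:C%:A) <= `|r|.
Proof. by rewrite nrm_rscale ler_piMr // nrm1_le1. Qed.

(** * Limits and fixed-point iteration *)

Definition tends (u : nat -> B) (l : B) := forall e : R, 0 < e ->
  exists N, forall n, (N <= n)%N -> nrm (u n - l) < e.

Lemma tends_uniq u l m : tends u l -> tends u m -> l = m.
Proof.
move=> ul um; apply/eqP; rewrite -subr_eq0; apply/eqP/(nrm_eq0 HB).
apply/le_anti; rewrite nrm_ge0 andbT leNgt; apply/negP => h.
have h2 : 0 < nrm (l - m) / 2 by rewrite divr_gt0.
have [N1 /(_ _ (leq_maxl _ _)) H1] := ul _ h2.
have [N2 /(_ _ (leq_maxr _ _)) H2] := um _ h2.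
have := nrm_dist_triangle (u (maxn N1 N2)) l m.
rewrite (nrm_distC l (u _)) => h3.
have := le_lt_trans h3 (ltrD (H1 _) (H2 _)).
by rewrite -splitr ltxx.
Qed.

Lemma tends_lip (C : R) (f : B -> B) u l m :
  (forall n, nrm (f (u n) - m) <= C * nrm (u n - l)) ->
  tends u l -> tends (f \o u) m.
Proof.
move=> h ul e e0.
(* [C] may be zero or negative; [|C| + 1] is positive and still bounds it. *)
have C0 : 0 < `|C| + 1 by rewrite ltr_wpDl.
have [N HN] := ul _ (divr_gt0 e0 C0).
exists N => n /HN; rewrite ltr_pdivlMr // => /= h2.
apply: le_lt_trans (h n) (le_lt_trans _ h2).
by rewrite mulrC ler_wpM2l ?nrm_ge0 // ler_wpDr // ler_norm.
Qed.

Lemma tends_contract (q : R) (u : nat -> B) : 0 <= q -> q < 1 ->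
  (forall n, nrm (u n.+2 - u n.+1) <= q * nrm (u n.+1 - u n)) ->
  exists l, tends u l.
Proof.
move=> q0 q1 hu; apply: (nrm_complete HB).
set C := nrm (u 1%N - u 0%N).
have C0 : 0 <= C by exact: nrm_ge0.
have h1 n : nrm (u n.+1 - u n) <= C * q ^+ n.
  elim: n => [|n IHn]; first by rewrite mulr1.
  by apply: le_trans (hu n) _; rewrite exprS mulrCA ler_wpM2l.
(* The telescoped geometric sum, multiplied by [1 - q] to stay free of division. *)
have h2 n k : (1 - q) * nrm (u (n + k)%N - u n) <= C * (q ^+ n - q ^+ (n + k)).
  elim: k => [|k IHk]; first by rewrite addn0 !subrr nrm0 !mulr0.
  have d0 : 0 <= 1 - q by rewrite subr_ge0 ltW.
  have := ler_wpM2l d0 (nrm_dist_triangle (u (n + k)%N) (u (n + k.+1)%N) (u n)).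
  have := ler_wpM2l d0 (h1 (n + k)%N).
  by rewrite addnS exprS; lra.
have h3 n m : (n <= m)%N -> (1 - q) * nrm (u m - u n) <= C * q ^+ n.
  move=> /subnKC <-; apply: le_trans (h2 _ _) _.
  by rewrite ler_wpM2l // gerBl exprn_ge0.
move=> e e0; have d0 : 0 < 1 - q by rewrite subr_gt0.
have C1 : 0 < C + 1 by rewrite ltr_wpDl.
have [N HN] := expr_small R q (e * (1 - q) / (C + 1)) q0 q1
  (divr_gt0 (mulr_gt0 e0 d0) C1).
have key n m : (N <= n)%N -> (n <= m)%N -> nrm (u m - u n) < e.
  move=> /HN hn /h3 hm; rewrite -(ltr_pM2l d0); apply: le_lt_trans hm _.
  move: hn; rewrite ltr_pdivlMr // [(1 - q) * e]mulrC => hn.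
  apply: le_lt_trans hn; rewrite mulrC ler_wpM2l ?exprn_ge0 // ; lra.
exists N => m n Nm Nn; have [nm|mn] := leqP n m; first exact: key.
by rewrite nrm_distC key // ltnW.
Qed.

Lemma tends_shift u l : tends u l -> tends (fun n => u n.+1) l.
Proof. by move=> ul e /ul[N HN]; exists N => n /leqW/HN. Qed.

Lemma tends_mull x u l : tends u l -> tends (fun n => x * u n) (x * l).
Proof.
by apply: (tends_lip (nrm x) (fun y => x * y)) => n; rewrite -mulrBr (nrm_mul HB).
Qed.

Lemma tends_mulr x u l : tends u l -> tends (fun n => u n * x) (l * x).
Proof.
apply: (tends_lip (nrm x) (fun y => y * x)) => n.
by rewrite -mulrBl mulrC (nrm_mul HB).
Qed.

Lemma tends_star u l : tends u l -> tends (fun n => star (u n)) (star l).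
Proof. by apply: (tends_lip 1 star) => n; rewrite -starB nrm_star mul1r. Qed.

Lemma tends_commute x u l :
  tends u l -> (forall n, x * u n = u n * x) -> x * l = l * x.
Proof.
move=> ul xu; apply: (tends_uniq _ _ _ (tends_mull x _ _ ul)).
have -> : (fun n => x * u n) = (fun n => u n * x) by apply/funext.
exact: tends_mulr.
Qed.

(** The Lipschitz bound is asked only between the iterates and the limit, so that quadratic maps,
    not globally Lipschitz, are covered. *)
Lemma tends_fixpoint (C : R) f u l : tends u l -> (forall n, u n.+1 = f (u n)) ->
  (forall n, nrm (f (u n) - f l) <= C * nrm (u n - l)) -> l = f l.
Proof.
move=> ul uf /tends_lip/(_ ul) fl; apply: (tends_uniq _ _ _ (tends_shift _ _ ul)).
by move=> e /fl[N HN]; exists N => n /HN; rewrite uf.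
Qed.

(** * Invertibility and the Neumann series *)

Lemma invertible_1B x : nrm x < 1 -> invertible (1 - x).
Proof.
(* The iterates are the partial sums of the Neumann series. The limit satisfies [l = 1 + x * l], a
   right inverse; as it commutes with [x], it is a left inverse too. *)
move=> x1; pose f y := 1 + x * y; pose u n := iter n f 0.
have fB y z : f y - f z = x * (y - z) by rewrite /f opprD addrACA subrr add0r -mulrBr.
have [l ul] : exists l, tends u l.
  apply: (tends_contract (nrm x)) => // [|n]; first exact: nrm_ge0.
  by rewrite {1}/u /= -!/(u _) -/(u n.+1) fB (nrm_mul HB).
have lf : l = f l.
  by apply: (tends_fixpoint (nrm x) f u) => // n; rewrite fB (nrm_mul HB).
have xl : x * l = l * x.
  apply: tends_commute ul _; elim=> [|n IHn]; first by rewrite mulr0 mul0r.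
  by rewrite /= /f mulrDr mulrDl mulr1 mul1r -mulrA -IHn.
exists l; split; rewrite ?mulrBl ?mulrBr ?mul1r ?mulr1 -?xl {1}lf /f addrK //.
Qed.

Lemma invertible_mul (x y : B) : invertible x -> invertible y -> invertible (x * y).
Proof.
move=> [a [ax xa]] [b [yb yb']]; exists (b * a).
by rewrite -!mulrA (mulrA a) ax mul1r (mulrA y) yb' mul1r.
Qed.

Lemma invertible_scale (a : R[i]) (x : B) : a != 0 -> invertible x -> invertible (a *: x).
Proof.
move=> a0 [y [yx xy]]; exists (a^-1 *: y).
by rewrite -!scalerAl -!scalerAr !scalerA xy yx mulfV // mulVf // scale1r.
Qed.

Lemma invertible_cabs (l : R[i]) x : nrm x < cabs l -> invertible (l%:A - x).
Proof.
move=> xl; have l0 : l != 0.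
  apply: contraTneq xl => ->; rewrite -leNgt.
  by rewrite (_ : cabs 0 = 0) ?nrm_ge0 // (cabs_real 0) normr0.
have -> : l%:A - x = l *: (1 - l^-1 *: x).
  by rewrite scalerBr scalerA mulfV // scale1r.
apply: invertible_scale => //; apply: invertible_1B.
rewrite (nrm_scale HB) /cabs ComplexField.Normc.normcV mulrC.
by rewrite ltr_pdivrMr ?mul1r // (le_lt_trans (nrm_ge0 x)).
Qed.

(** * Square roots near the identity *)

Lemma scale_half_double (x : B) : (2^-1)%:C *: x + (2^-1)%:C *: x = x.
Proof. by rewrite -scalerDl -rmorphD -[2^-1]div1r -splitr scale1r. Qed.

(* The root is [1 - y], where [y] is the fixed point of [y |-> (l + y^2) / 2]. *)
Lemma sqrt_1B l : star l = l -> nrm l < 1 -> exists w,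
  [/\ star w = w, w * w = 1 - l & forall x, x * l = l * x -> x * w = w * x].
Proof.
move=> sl q1; set q := nrm l in q1; have q0 : 0 <= q by exact: nrm_ge0.
have h0 : 0 <= 2^-1 :> R by rewrite invr_ge0.
pose f y := (2^-1)%:C *: (l + y * y); pose u n := iter n f 0.
(* The ball of radius [q] is preserved since (q + q^2)/2 <= q, and [f] contracts it with constant
   [q]. *)
have uq n : nrm (u n) <= q.
  elim: n => [|n IHn]; first by rewrite nrm0.
  rewrite /= /f nrm_pscale //; have := nrm_add HB l (u n * u n).
  have := nrm_mul HB (u n) (u n); have := nrm_ge0 (u n).
  rewrite -/(u n) -/q; nra.
have fB y z : nrm (f y - f z) <= 2^-1 * (nrm y + nrm z) * nrm (y - z).
  have -> : f y - f z = (2^-1)%:C *: (y * (y - z) + (y - z) * z).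
    by rewrite /f -scalerBr opprD addrACA subrr add0r mulrBr mulrBl subrKA.
  rewrite nrm_pscale // -mulrA ler_wpM2l // (mulrDl (nrm y)) (mulrC (nrm z)).
  by apply: le_trans (nrm_add HB _ _) _; rewrite lerD ?(nrm_mul HB).
have [y uy] : exists y, tends u y.
  apply: (tends_contract q) => // n.
  apply: le_trans (fB (u n.+1) (u n)) _; rewrite ler_wpM2r ?nrm_ge0 //.
  by have := uq n; have := uq n.+1; lra.
have yf : y = f y.
  apply: (tends_fixpoint (2^-1 * (q + nrm y)) f u) => // n.
  apply: le_trans (fB _ _) _; rewrite ler_wpM2r ?nrm_ge0 // ler_wpM2l //.
  by rewrite lerD2r.
have sy : star y = y.
  apply: (tends_uniq (fun n => star (u n)) _ _ (tends_star _ _ uy)).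
  have -> // : (fun n => star (u n)) = u.
  apply/funext; elim=> [|n IHn]; first exact: star0.
  by rewrite /= /f star_rscale (star_add HB) sl (star_mul HB) IHn.
exists (1 - y); split; first by rewrite starB star1 sy.
  have yy : y + y = l + y * y by rewrite {1 2}yf scale_half_double.
  by rewrite mulrBr mulr1 mulrBl mul1r -addrA -opprD addrA yy addrK.
move=> x xl; rewrite mulrBr mulrBl mulr1 mul1r; congr (_ - _).
apply: tends_commute uy _; elim=> [|n IHn]; first by rewrite mulr0 mul0r.
by rewrite /= /f -scalerAr -scalerAl mulrDr mulrDl xl mulrA IHn -!mulrA IHn.
Qed.

(** * Norm and spectrum of a self-adjoint element *)

Lemma nrm_sqr_le_add k q : star k = k -> star q = q -> k * q = q * k ->
  nrm k ^+ 2 <= nrm (k * k + q * q).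
Proof.
(* As [k] and [q] commute, |x|^2 = |k^2 + q^2|, while 2k = x + x^* gives |k| <= |x|. *)
move=> sk sq kq; set x := k + 'i *: q.
have sx : star x = k - 'i *: q.
  rewrite (star_add HB) (star_scale HB) sk sq -scaleNr; congr (_ + _ *: _).
  by apply/eqP; rewrite eq_complex /= oppr0 !eqxx.
have <- : star x * x = k * k + q * q.
  rewrite sx /x mulrDr !mulrBl -!scalerAr -!scalerAl kq addrA subrK scalerA.
  have -> : 'i * 'i = -1 :> R[i].
    by apply/eqP; rewrite eq_complex /= !mulr0 !mul0r mulr1 addr0 sub0r oppr0 !eqxx.
  by rewrite scaleN1r opprK.
rewrite (nrm_cstar HB) ler_sqr ?nnegrE ?nrm_ge0 //.
have : nrm (k + k) <= nrm x + nrm (star x).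
  have -> : k + k = x + star x by rewrite sx /x addrACA subrr addr0.
  exact: nrm_add HB _ _.
rewrite nrm_star; have -> : nrm (k + k) = 2 * nrm k.
  rewrite -(nrm_pscale 2) //; congr (nrm _).
  by rewrite rmorphD rmorph1 scalerDl scale1r.
by lra.
Qed.

Lemma inverse_sa (x y : B) : star x = x -> x * y = 1 -> star y = y.
Proof.
move=> sx xy; have yx : star y * x = 1 by rewrite -{1}sx -(star_mul HB) xy star1.
by rewrite -[LHS]mulr1 -xy mulrA yx mul1r.
Qed.

Lemma inverse_commute (x y z : B) : y * x = 1 -> x * y = 1 -> z * x = x * z ->
  z * y = y * z.
Proof.
move=> yx xy zx; rewrite -[z * y]mul1r -yx -!mulrA; congr (_ * _).
by rewrite (mulrA x) -zx -mulrA xy mulr1.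
Qed.

(* With [A = 1 - s^2 k^2] for [s < 1] close to [1], [1 - k^2] being invertible
   bounds [A^-1] independently of [s]; so for a fixed [mu > 0] the element
   [A - mu = A (1 - mu A^-1)] is the square of a self-adjoint [q] commuting with
   [k], and [s^2 k^2 + q^2 = 1 - mu]. *)
Lemma nrm_lt1 k : star k = k -> nrm k <= 1 -> invertible (1 - k * k) -> nrm k < 1.
Proof.
move=> sk k1 [Z [Zk _]]; rewrite lt_neqAle k1 andbT; apply/eqP => {}k1.
set l := k * k in Zk; have sl : star l = l by rewrite (star_mul HB) sk.
have l1 : nrm l <= 1 by rewrite nrm_sqr_sa // k1 expr1n.
set N := nrm Z + 1; have Z0 := nrm_ge0 Z.
have N0 : 0 < N by rewrite /N; lra.
(* This size of [t] makes (1 - s^2) N <= 2tN = 1/8, so that the identity [XE] below yields |X| <=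
   |Z| + |X|/8. *)
set t := (16 * N)^-1; have tN : t * N = 16^-1.
  by rewrite /t invfM -mulrA mulVf ?mulr1 // gt_eqF.
have t0 : 0 < t by rewrite invr_gt0 mulr_gt0.
have t1 : t <= 16^-1 by rewrite -tN ler_peMr ?(ltW t0) // /N; lra.
set s := 1 - t; set k' := s%:C *: k; set l' := k' * k'.
have s0 : 0 <= s by rewrite /s; lra.
have sk' : star k' = k' by rewrite star_rscale sk.
have nk' : nrm k' = s by rewrite nrm_pscale // k1 mulr1.
have sl' : star l' = l' by rewrite (star_mul HB) sk'.
have nl' : nrm l' < 1 by rewrite nrm_sqr_sa // nk' /s; nra.
set A := 1 - l'; have sA : star A = A by rewrite starB star1 sl'.
have [X [XA AX]] : invertible A by exact: invertible_1B.
have l'E : l' = (s ^+ 2)%:C *: l.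
  by rewrite /l' /k' -scalerAl -scalerAr scalerA -rmorphM.
(* Compare the inverses of [1 - l] and [A]: expand [Z * (1 - l) * X] in two ways. *)
have XE : X = Z - (1 - s ^+ 2)%:C *: (Z * (l * X)).
  have e : (1 - l) * X = 1 - (1 - s ^+ 2)%:C *: (l * X).
    rewrite -[X in _ = X - _]AX /A l'E rmorphB rmorph1 !mulrBl mul1r scalerBl scale1r -scalerAl.
    by rewrite opprB addrA subrK.
  by rewrite -[LHS]mul1r -Zk -mulrA e mulrBr mulr1 -scalerAr.
have nX : nrm X <= 2 * N.
  have s2 : 0 <= 1 - s ^+ 2 by rewrite /s; nra.
  have := nrmB Z ((1 - s ^+ 2)%:C *: (Z * (l * X))); rewrite -XE nrm_pscale //.
  have x0 := nrm_ge0 X.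
  have : nrm (Z * (l * X)) <= N * nrm X.
    apply: le_trans (nrm_mul HB _ _) _; apply: ler_pM; rewrite ?nrm_ge0 //.
      by rewrite /N; lra.
    by apply: le_trans (nrm_mul HB _ _) _; rewrite ler_piMl.
  move=> /(ler_wpM2l s2) h1 h2.
  have h3 : (1 - s ^+ 2) * (N * nrm X) <= 8^-1 * nrm X.
    rewrite mulrA ler_wpM2r //.
    have : (1 - s ^+ 2) * N <= (2 * t) * N by rewrite ler_wpM2r ?(ltW N0) // /s; nra.
    by rewrite -mulrA tN; lra.
  by rewrite /N in h1 h2 h3 *; lra.
have [w [sw ww wc]] := sqrt_1B l' sl' nl'.
have sX : star X = X by exact: (inverse_sa A).
(* Small enough that mu |X| <= 8tN = 1/2, so [1 - mu X] has a root [z]; large enough that 1 - mu <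
   (1 - t)^2 = s^2. *)
set mu := 4 * t; have mu0 : 0 <= mu by rewrite /mu; lra.
have [||z [sz zz zc]] := sqrt_1B (mu%:C *: X) _ _.
- by rewrite star_rscale sX.
- rewrite nrm_pscale //; apply: le_lt_trans (ler_wpM2l mu0 nX) _.
  by rewrite /mu mulrCA -!mulrA tN; lra.
have XC x : x * l' = l' * x -> x * X = X * x.
  move=> xl; apply: (inverse_commute A) => //.
  by rewrite /A mulrBr mulrBl mulr1 mul1r xl.
have kl : k' * l' = l' * k' by rewrite /l' mulrA.
have kz : k' * z = z * k' by apply: zc; rewrite -[LHS]scalerAr -[RHS]scalerAl (XC _ kl).
have wl : w * l' = l' * w.
  by have := congr1 (fun x => 1 - x) ww; rewrite subKr => <-;
     rewrite mulrBr mulrBl mulr1 mul1r mulrA.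
have wz : w * z = z * w by apply: zc; rewrite -[LHS]scalerAr -[RHS]scalerAl (XC _ wl).
have kw : k' * w = w * k' by exact: wc.
have qq : (w * z) * (w * z) = A - mu%:C%:A.
  rewrite -mulrA (mulrA z) -wz !mulrA ww -mulrA zz.
  by rewrite mulrBr mulr1 -scalerAr AX.
(* With q = w z this gives s^2 <= |1 - mu| = 1 - 4t, contradicting s^2 >= 1 - 2t. *)
have := nrm_sqr_le_add k' (w * z) sk'; rewrite -/l' qq.
rewrite (star_mul HB) sz sw wz -wz mulrA kw -mulrA kz mulrA => /(_ erefl erefl).
rewrite nk' /A addrA (addrC l') subrK.
have := nrm_alg_le (1 - mu); rewrite rmorphB rmorph1 scalerBl scale1r.
rewrite ger0_norm /mu /s; first by nra.
by lra.
Qed.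

(** * Spectral positivity in terms of the norm *)

Lemma invertible_nonreal h (l : R[i]) : star h = h -> complex.Im l != 0 ->
  invertible (l%:A - h).
Proof.
case: l => a b sh /= b0; set N := nrm h.
(* Arens' shift: adding [i t] to both [l] and [h] leaves the difference unchanged. Since 2bt = N^2,
   |h + it|^2 <= N^2 + t^2 < (b + t)^2. *)
pose t := N ^+ 2 / (2 * b).
have -> : (a +i* b)%:A - h = (a +i* (b + t))%:A - (h + (0 +i* t)%:A).
  rewrite opprD addrA addrAC -scalerBl; congr (_ *: _ - _).
  by apply/eqP; rewrite eq_complex /= subr0 addrK !eqxx.
apply: invertible_cabs; rewrite -(@ltr_pXn2r _ 2) ?nnegrE ?nrm_ge0 ?sqrtr_ge0 //.
rewrite /cabs /= sqr_sqrtr ?addr_ge0 ?sqr_ge0 // -(nrm_cstar HB).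
have -> : star (h + (0 +i* t)%:A) * (h + (0 +i* t)%:A) = h * h + (t ^+ 2)%:C%:A.
  rewrite (star_add HB) (star_scale HB) star1 sh mulrDl !mulrDr.
  rewrite -!scalerAl -!scalerAr !mul1r mulr1 scalerA -addrA; congr (_ + _).
  rewrite addrA -scalerDl.
  have -> : (0 +i* t + (0 +i* t)^*) = 0 :> R[i].
    by apply/eqP; rewrite eq_complex /= addr0 subrr !eqxx.
  rewrite scale0r add0r; congr (_ *: _).
  by apply/eqP; rewrite eq_complex /= !mulr0 !mul0r addr0 sub0r mulNr opprK expr2 !eqxx.
apply: le_lt_trans (nrm_add HB _ _) _; rewrite nrm_sqr_sa // -/N.
have := nrm_alg_le (t ^+ 2); rewrite ger0_norm ?sqr_ge0 // => h1.
have tb : 2 * (b * t) = N ^+ 2 by rewrite /t; field; rewrite b0.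
have b2 : 0 < b ^+ 2 by rewrite exprn_even_gt0.
have := sqr_ge0 a; nra.
Qed.

Lemma positive_of_nrm (r : R) a : star a = a -> nrm (r%:C%:A - a) <= r -> positive star a.
Proof.
move=> sa ra; split=> // l nl; apply: contrapT => l0; apply: nl.
have [Il|Il] := eqVneq (complex.Im l) 0; last exact: invertible_nonreal.
have r0 : 0 <= r by apply: le_trans ra; exact: nrm_ge0.
case: l Il l0 => x y /= -> /negP; rewrite lecE /= eqxx /= -ltNge => x0.
(* For real x < 0, the norm of [r - a] is at most r < r - x, so the difference is invertible. *)
have -> : (x +i* 0)%:A - a = (r%:C%:A - a) - (r - x)%:C%:A.
  rewrite addrAC -scalerBl -rmorphB; congr (_%:C *: _ - _).
  by rewrite subKr.
rewrite -opprB -scaleN1r; apply: invertible_scale; first by rewrite oppr_eq0 oner_eq0.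
apply: invertible_cabs; rewrite cabs_real ger0_norm ?subr_ge0; lra.
Qed.

(** Suppose h = r - a has norm p > r. Then p + h = (p + r) - a is invertible because p + r > |a|,
    and p - h because r - p < 0 is outside the spectrum of [a]. So 1 - (h/p)^2 is invertible, which
    [nrm_lt1] forbids for an element of norm 1. *)
Lemma nrm_of_positive a : positive star a -> nrm ((nrm a)%:C%:A - a) <= nrm a.
Proof.
move=> [sa pa]; set r := nrm a; set h := _ - a; set p := nrm h.
rewrite leNgt; apply/negP => rp.
have r0 : 0 <= r by exact: nrm_ge0.
have p0 : 0 < p by exact: le_lt_trans rp.
have sh : star h = h by rewrite starB star_rscale star1 sa.
have i1 : invertible (p%:C%:A + h).
  rewrite /h addrA -scalerDl -rmorphD; apply: invertible_cabs.
  by rewrite cabs_real ger0_norm ?addr_ge0 // -?/r; lra.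
have i2 : invertible (p%:C%:A - h).
  have -> : p%:C%:A - h = - 1 *: ((r - p)%:C%:A - a).
    by rewrite /h scaleN1r rmorphB scalerBl opprB !opprD !opprK addrA addrC -addrA addrC.
  apply: invertible_scale; first by rewrite oppr_eq0 oner_eq0.
  by apply: contrapT => /pa; rewrite ler0c; lra.
pose k := (p^-1)%:C *: h.
have sk : star k = k by rewrite star_rscale sh.
have nk : nrm k = 1 by rewrite nrm_pscale ?invr_ge0 ?(ltW p0) // mulVf // gt_eqF.
have : nrm k < 1; last by rewrite nk ltxx.
apply: nrm_lt1; rewrite ?nk //.
have -> : 1 - k * k = (p^-2)%:C *: ((p%:C%:A - h) * (p%:C%:A + h)).
  have -> (x : B) : (p%:C%:A - x) * (p%:C%:A + x) = (p ^+ 2)%:C%:A - x * x.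
    rewrite mulrDr !mulrBl -!scalerAl -!scalerAr !mul1r mulr1 scalerA -rmorphM.
    by rewrite addrA subrK.
  rewrite /k -scalerAl -scalerAr scalerA -rmorphM scalerBr scalerA -rmorphM -expr2 exprVn.
  by rewrite mulVf ?scale1r // expf_eq0 /= gt_eqF.
apply: invertible_scale; last exact: invertible_mul.
by rewrite fmorph_eq0 invr_eq0 expf_eq0 /= gt_eqF.
Qed.

Lemma positiveD a b : positive star a -> positive star b -> positive star (a + b).
Proof.
move=> pa pb; have [sa _] := pa; have [sb _] := pb.
apply: (positive_of_nrm (nrm a + nrm b)); first by rewrite (star_add HB) sa sb.
rewrite rmorphD scalerDl opprD addrACA.
by apply: le_trans (nrm_add HB _ _) _; rewrite lerD ?nrm_of_positive.
Qed.

Lemma positive0 : positive star 0.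
Proof. by apply: (positive_of_nrm 0); rewrite ?star0 // scale0r subr0 nrm0. Qed.

(** * Bounded maps and operations on CPD kernels *)

Lemma bounded_linear0 : bounded_linear nrm (fun _ : B => 0).
Proof.
split; first by move=> x y; rewrite addr0.
split; first by move=> a x; rewrite scaler0.
by exists 0 => x; rewrite nrm0 mul0r.
Qed.

Lemma bounded_linearD (f g : B -> B) : bounded_linear nrm f -> bounded_linear nrm g ->
  bounded_linear nrm (fun x => f x + g x).
Proof.
move=> [fD [fZ [Mf fM]]] [gD [gZ [Mg gM]]]; split.
  by move=> x y; rewrite fD gD addrACA.
split; first by move=> a x; rewrite fZ gZ scalerDr.
exists (Mf + Mg) => x; rewrite mulrDl.
by apply: le_trans (nrm_add HB _ _) _; rewrite lerD.
Qed.

Lemma bounded_linear_sandwich (x y : B) : bounded_linear nrm (fun b => x * b * y).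
Proof.
split; first by move=> a b; rewrite mulrDr mulrDl.
split; first by move=> a b; rewrite -scalerAr -scalerAl.
exists (nrm x * nrm y) => b; apply: le_trans (nrm_mul HB _ _) _.
by rewrite mulrAC ler_wpM2r ?nrm_ge0 ?(nrm_mul HB).
Qed.

Lemma CPD_add {S : Type} (K L : S -> S -> B -> B) :
  CPD star nrm K -> CPD star nrm L ->
  CPD star nrm (fun s s' b => K s s' b + L s s' b).
Proof.
move=> [Kb Kp] [Lb Lp]; split=> [s s'|n s a b]; first exact: bounded_linearD.
rewrite (_ : \sum_i _ = (\sum_(i < n) \sum_(j < n)
    star (b i) * K (s i) (s j) (star (a i) * a j) * b j) +
  \sum_(i < n) \sum_(j < n) star (b i) * L (s i) (s j) (star (a i) * a j) * b j).
  exact: positiveD.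
rewrite -big_split; apply: eq_bigr => i _; rewrite -big_split /=.
by apply: eq_bigr => j _; rewrite mulrDr mulrDl.
Qed.

(** Indices that [f] sends to [None] are moved to a dummy point [x0] with coefficient 0, which turns
    the double sum into one for [K]. *)
Lemma CPD_zero_extension {S S0 : Type} (f : S -> option S0) (K : S0 -> S0 -> B -> B) :
  CPD star nrm K ->
  CPD star nrm (fun s s' b => if f s is Some x then
    if f s' is Some y then K x y b else 0 else 0).
Proof.
move=> [Kb Kp]; split=> [s s'|n s a b].
  by case: (f s) => [x|]; [case: (f s') => [y|]|]; [exact: Kb|exact: bounded_linear0..].
(* A dummy point is available only if some index has a value under [f]; otherwise every term
   vanishes. *)
have [i0 /= fi0|none] := pickP (fun i => f (s i)); last first.
  rewrite big1 => [|i _]; first exact: positive0.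
  rewrite big1 // => j _; have := none i; case: (f (s i)) => // _.
  by rewrite mulr0 mul0r.
case E: (f (s i0)) fi0 => [x0|] // _.
pose s' i := odflt x0 (f (s i)); pose b' i := if f (s i) is Some _ then b i else 0.
rewrite (_ : \sum_i _ = \sum_(i < n) \sum_(j < n)
    star (b' i) * K (s' i) (s' j) (star (a i) * a j) * b' j); first exact: Kp.
apply: eq_bigr => i _; apply: eq_bigr => j _; rewrite /s' /b'.
case: (f (s i)) => [x|] /=; last by rewrite star0 mulr0 !mul0r.
by case: (f (s j)) => [y|] //=; rewrite !mulr0 ?mul0r.
Qed.

(** * Elementary kernels and their continuity *)

Lemma CPD_elementary {S : Type} (c : S -> B) :
  (S -> forall x, positive star (star x * x)) ->
  CPD star nrm (fun s s' b => star (c s) * b * c s').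
Proof.
move=> sq; split=> [s s'|[|n] s a b]; first exact: bounded_linear_sandwich.
  by rewrite big_ord0; exact: positive0.
(* The double sum is a square; [s ord0] is the point of [S] from which positivity of squares is
   drawn. *)
rewrite (_ : \sum_i _ = star (\sum_i a i * c (s i) * b i) * \sum_i a i * c (s i) * b i).
  exact: sq (s ord0) _.
rewrite star_sum big_distrl; apply: eq_bigr => i _.
rewrite big_distrr; apply: eq_bigr => j _.
by rewrite /= !(star_mul HB) !mulrA.
Qed.

(* As [T_0] is the identity, its complete positivity yields [x^* x >= 0]. *)
Lemma CPD_semigroup_sqr {S : Type} (T : R -> S -> S -> B -> B) :
  CPD_semigroup star nrm T -> S -> forall x, positive star (star x * x).
Proof.
move=> [Tcpd [T0 _]] s x; have [_] := Tcpd 0 (lexx 0).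
move=> /(_ 1%N (fun=> s) (fun=> x) (fun=> 1)).
by rewrite !big_ord1 T0 star1 mul1r mulr1.
Qed.

Lemma elementary_elementary_of {S : Type} (c : S -> R -> B) :
  (S -> forall x, positive star (star x * x)) ->
  (forall s, cont_semigroup nrm (c s)) -> elementary star nrm (elementary_of star c).
Proof.
move=> sq hc; split; last by exists c.
split; first by move=> t _; exact: (CPD_elementary (fun s => c s t)).
split=> [s s' b|t u s s' b t0 u0].
  by rewrite /elementary_of (hc s).1 (hc s').1 star1 mul1r mulr1.
have [_ [cD _]] := hc s; have [_ [cD' _]] := hc s'.
(* Written as c_u c_t, the product has its [u] factors next to [b], as the composite T_t T_u
   requires. *)
by rewrite /elementary_of (addrC t) cD // cD' // (star_mul HB) !mulrA.
Qed.

(** The bound is uniform in [x], so it serves operator-norm and strong continuity alike. *)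
Lemma norm_continuous_sandwich (c c' : R -> B) :
  norm_continuous nrm c -> norm_continuous nrm c' ->
  forall t0, 0 <= t0 -> forall e : R, 0 < e -> exists d : R, 0 < d /\
    forall t, 0 <= t -> `|t - t0| < d -> forall x,
      nrm (star (c t) * x * c' t - star (c t0) * x * c' t0) <= e * nrm x.
Proof.
move=> hc hc' t0 t00 e e0; set C := nrm (c t0) + nrm (c' t0) + 2.
have n1 := nrm_ge0 (c t0); have n2 := nrm_ge0 (c' t0).
have C0 : 0 < C by rewrite /C; lra.
(* The cap 1 bounds |c'_t| by |c'_t0| + 1; with g = e/C the two error terms sum to at most g (C - 1)
   <= e. *)
have e1 : 0 < Num.min 1 (e / C) by rewrite lt_min ltr01 divr_gt0.
have [d [d0 hd]] := hc t0 t00 _ e1; have [d' [d'0 hd']] := hc' t0 t00 _ e1.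
exists (Num.min d d'); split; first by rewrite lt_min d0.
move=> t tge; rewrite lt_min => /andP[/(hd t tge) h /(hd' t tge) h'] x.
move: h h'; rewrite !lt_min => /andP[h1 h2] /andP[h3 h4].
have -> : star (c t) * x * c' t - star (c t0) * x * c' t0 =
    star (c t - c t0) * x * c' t + star (c t0) * x * (c' t - c' t0).
  by rewrite starB !mulrBl mulrBr addrA subrK.
have bnd (y z : B) : nrm (star y * x * z) <= nrm y * nrm z * nrm x.
  apply: le_trans (nrm_mul HB _ _) _; rewrite mulrAC ler_wpM2r ?nrm_ge0 //.
  by apply: le_trans (nrm_mul HB _ _) _; rewrite nrm_star.
apply: le_trans (nrm_add HB _ _) _; apply: le_trans (lerD (bnd _ _) (bnd _ _)) _.
rewrite -mulrDl ler_wpM2r ?nrm_ge0 //.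
have h5 : nrm (c' t) <= nrm (c' t0) + 1.
  by have := nrm_add HB (c' t - c' t0) (c' t0); rewrite subrK; lra.
have eC : e = e / C * (nrm (c t0) + (nrm (c' t0) + 1) + 1).
  by rewrite -!addrA addrA -[1 + 1]/2 -/C divfK // gt_eqF.
have ec0 : 0 < e / C by exact: divr_gt0.
rewrite {}eC; move: (e / C) ec0 h2 h4 => g g0 h2 h4.
have i1 := ler_pM (nrm_ge0 _) (nrm_ge0 _) (ltW h2) h5.
have i2 := ler_wpM2l n1 (ltW h4).
lra.
Qed.

End CStar.

(** * The sum of two spatial CPD-semigroups *)

Definition sum_family {R : realType} {B : algType R[i]} {S1 S2 : Type}
  (c1 : S1 -> R -> B) (c2 : S2 -> R -> B) (s : S1 + S2) : R -> B :=
  match s with inl x => c1 x | inr y => c2 y end.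

Theorem theorem3p1 (R : realType) (B : algType R[i]) (star : B -> B) (nrm : B -> R)
  (HB : cstar_algebra star nrm)
  (S1 S2 : Type)
  (T1 : R -> S1 -> S1 -> B -> B) (T2 : R -> S2 -> S2 -> B -> B)
  (c1 : S1 -> R -> B) (c2 : S2 -> R -> B) :
  spatial star nrm T1 -> spatial star nrm T2 ->
  (forall s, cont_semigroup nrm (c1 s)) -> (forall s, cont_semigroup nrm (c2 s)) ->
  is_unit star nrm T1 (elementary_of star c1) ->
  is_unit star nrm T2 (elementary_of star c2) ->
  let T := boxplus star T1 T2 c1 c2 in
  let Sg := boxplus star (elementary_of star c1) (elementary_of star c2) c1 c2 in
  [/\ spatial star nrm T, is_unit star nrm T Sg,
      (uniformly_continuous nrm T <->
         uniformly_continuous nrm T1 /\ uniformly_continuous nrm T2)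
    & (strongly_continuous nrm T <->
         strongly_continuous nrm T1 /\ strongly_continuous nrm T2)].
Proof.
move=> [T1s _] [T2s _] hc1 hc2 [_ dom1] [_ dom2] T Sg.
have sq : S1 + S2 -> forall x, positive star (star x * x).
  by case=> s; [exact: CPD_semigroup_sqr T1s s | exact: CPD_semigroup_sqr T2s s].
pose c := sum_family c1 c2.
have hc s : cont_semigroup nrm (c s) by case: s => s; [exact: hc1|exact: hc2].
have SgE : Sg = elementary_of star c.
  by apply/funext => t; apply/funext => -[x|x]; apply/funext => -[y|y].
have el : elementary star nrm Sg by rewrite SgE; exact: elementary_elementary_of.
(* The off-diagonal blocks of [T] and [Sg] agree, so the difference is block diagonal. *)
have dom : dominates star nrm T Sg.
  move=> t t0.
  have := CPD_add HB _ _
    (CPD_zero_extension HB (fun s : S1 + S2 => if s is inl x then Some x else None)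
      _ (dom1 t t0))
    (CPD_zero_extension HB (fun s : S1 + S2 => if s is inr x then Some x else None)
      _ (dom2 t t0)).
  congr CPD; apply/funext => -[x|x]; apply/funext => -[y|y]; apply/funext => b /=;
    by rewrite ?addr0 ?add0r // subrr.
(* T_t = (T_t - S_t) + S_t is CPD; the semigroup laws are checked block by block. *)
have Ts : CPD_semigroup star nrm T.
  have [[Sgcpd [Sg0 SgD]] _] := el; split=> [t t0|].
    have := CPD_add HB _ _ (dom t t0) (Sgcpd t t0).
    by congr CPD; do 3!apply/funext => ?; rewrite subrK.
  have [_ [T10 T1D]] := T1s; have [_ [T20 T2D]] := T2s; split.
    move=> [x|x] [y|y] b; [exact: T10|exact: (Sg0 (inl x) (inr y))| |exact: T20].
    exact: (Sg0 (inr x) (inl y)).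
  move=> t u [x|x] [y|y] b t0 u0; [exact: T1D|exact: (SgD t u (inl x) (inr y))| |exact: T2D].
  exact: (SgD t u (inr x) (inl y)).
(* Only the off-diagonal blocks of [T], which are those of [Sg], need this continuity. *)
have cross s s' : forall t0, 0 <= t0 -> forall e : R, 0 < e -> exists d : R, 0 < d /\
    forall t, 0 <= t -> `|t - t0| < d ->
      forall x, nrm (Sg t s s' x - Sg t0 s s' x) <= e * nrm x.
  rewrite SgE; apply: (norm_continuous_sandwich HB); [exact: (hc s).2.2|exact: (hc s').2.2].
have cross_strong s s' b : norm_continuous nrm (fun t => Sg t s s' b).
  move=> t0 t00 e e0; have b0 := nrm_ge0 HB b.
  have b1 : 0 < nrm b + 1 by lra.
  have [d [d0 hd]] := cross s s' t0 t00 _ (divr_gt0 e0 b1).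
  exists d; split=> // t tge td; apply: le_lt_trans (hd t tge td b) _.
  by rewrite mulrAC ltr_pdivrMr // ltr_pM2l //; lra.
split=> //.
- by split=> //; exists Sg.
- split=> [uT|[u1 u2]].
    by split=> x y; [exact: (uT (inl x) (inl y))|exact: (uT (inr x) (inr y))].
  move=> [x|x] [y|y]; [exact: u1|exact: (cross (inl x) (inr y))| |exact: u2].
  exact: (cross (inr x) (inl y)).
- split=> [uT|[u1 u2]].
    by split=> x y; [exact: (uT (inl x) (inl y))|exact: (uT (inr x) (inr y))].
  move=> [x|x] [y|y]; [exact: u1|exact: (cross_strong (inl x) (inr y))| |exact: u2].
  exact: (cross_strong (inr x) (inl y)).
Qed.
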